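(* Let $p$ be an odd prime. Any $cl_p$ group $G$ has a subquotient that is a simple $cl_p$ group.
   Context: For a prime $p$, a finite group $G$ is called a $cl_p$ group if the Sylow $p$-subgroups of $G$ are non-abelian and, for every $p$-element $x\in G$ (element of $p$-power order), the size of the conjugacy class of $x$ in $G$ is not divisible by $p$. A subquotient of $G$ is a group of the form $H/K$ with $K\lhd H\leq G$. *)

(* Defs.v *)
From HB Require Import structures.
From mathcomp Require Import all_boot all_fingroup all_solvable.

Set Implicit Arguments.
Unset Strict Implicit.
Unset Printing Implicit Defensive.

Import GroupScope.

Definition cl_group (p : nat) (gT : finGroupType) (G : {group gT}) : Prop :=
  (forall P : {group gT}, P \in 'Syl_p(G) -> ~~ abelian P) /\
  (forall x : gT, x \in G -> p.-elt x -> ~~ (p %| #|x ^: G|)).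

(* Main.v *)
(** Let [N] be normal in a group [G] whose [p]-elements have class size prime
    to [p], and suppose that [N] and [G / N] have abelian Sylow [p]-subgroups.
    Then so has [G].  Let [P] be a Sylow [p]-subgroup of [G], [Q = N :&: P] and
    [x \in P].  Since [x] is central in some Sylow subgroup of [G], the group
    [N<x>] has an abelian Sylow [p]-subgroup, and [Q<x>] is another one: so [Q]
    is central in [P].  Also [x ^ g \in 'Z(P)] for some [g], and as [P / N] is
    abelian, Burnside's fusion argument in [G / N] replaces [g] by some [n]
    normalising [P] with [x ^ n \in Q * x ^ g].  Hence [x ^ n \in 'Z(P)], and
    [x \in 'Z(P)].

    As the condition on class sizes passes to normal subgroups and quotients,
    either a maximal normal subgroup [K] of a [cl_p] group [G] or the simple
    group [G / K] is a [cl_p] group; in the former case, descend to [K]. *)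

Require Import Defs.
From HB Require Import structures.
From mathcomp Require Import all_boot all_fingroup all_solvable.

Set Implicit Arguments.
Unset Strict Implicit.
Unset Printing Implicit Defensive.

Import GroupScope.

(** Isolates the half of [cl_group] that normal subgroups and quotients inherit. *)
Definition p'_classes (p : nat) (gT : finGroupType) (G : {group gT}) : Prop :=
  forall x : gT, x \in G -> p.-elt x -> ~~ (p %| #|x ^: G|).

Section ClassSizes.

Variables (p : nat) (p_prime : prime p) (gT : finGroupType).
Implicit Types G N P R : {group gT}.

(** A Sylow [p]-subgroup of ['C_G[x]] is Sylow in [G], the index being prime to [p], and it contains
    [<[x]>], a normal [p]-subgroup of ['C_G[x]]. *)
Lemma Sylow_center_p'classes G x :
    p'_classes p G -> x \in G -> p.-elt x ->
  exists2 P : {group gT}, p.-Sylow(G) P & x \in 'Z(P).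
Proof.
move=> clG Gx px; have := clG x Gx px; rewrite -index_cent1 => p'ind.
have [P sylP] := Sylow_exists p 'C_G[x].
have sPC := pHall_sub sylP.
have cxP : x \in 'C(P) by rewrite -sub_cent1 (subset_trans sPC) ?subsetIr.
have sPG : P \subset G := subset_trans sPC (subsetIl _ _).
exists P.
  rewrite pHallE sPG (card_Hall sylP) -(Lagrange (subsetIl G 'C[x])) /=.
  by rewrite partnM ?cardG_gt0 // (@part_p'nat p #|G : _|) ?muln1 // p'natE.
rewrite inE cxP andbT -cycle_subG.
apply: subset_trans (pcore_sub_Hall sylP); apply: pcore_max => //.
by rewrite subcent1_cycle_normal.
Qed.

Lemma p'_classes_normal G N : N <| G -> p'_classes p G -> p'_classes p N.
Proof.
move=> nNG clG x Nx px; have sNG := normal_sub nNG.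
have [P sylP] := Sylow_center_p'classes clG (subsetP sNG x Nx) px.
case/setIP=> _ cxP; have sylQ := Sylow_setI_normal nNG sylP.
rewrite -index_cent1 -p'natE //.
apply: (@pnat_dvd _ #|N : N :&: P|); last by case/and3P: sylQ.
by rewrite indexgS // setIS // sub_cent1.
Qed.

Lemma p'_classes_quotient G N :
  N <| G -> p'_classes p G -> p'_classes p (G / N)%G.
Proof.
move=> nNG clG _ /morphimP[x nNx Gx ->] px.
(* The lift [x] need not be a [p]-element, but its [p]-part has the same image in [G / N]. *)
have [P sylP cxP] : exists2 P : {group gT}, p.-Sylow(G) P & x.`_p \in 'Z(P).
  by apply: Sylow_center_p'classes; rewrite ?p_elt_constt ?groupX.
have -> : coset_morphism N x = coset N x.`_p.
  by rewrite morph_constt // constt_p_elt.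
have nNP := subset_trans (pHall_sub sylP) (normal_norm nNG).
have sylPN := quotient_pHall nNP sylP.
rewrite -index_cent1 -p'natE //.
apply: (@pnat_dvd _ #|G / N : P / N|); last by case/and3P: sylPN.
rewrite indexgS // subsetI quotientS ?(pHall_sub sylP) //=.
by rewrite quotient_cent1s // sub_cent1; case/setIP: cxP.
Qed.

Lemma abelian_Sylow_trans G P R :
  p.-Sylow(G) P -> p.-Sylow(G) R -> abelian P -> abelian R.
Proof.
move=> sylP sylR abP; have [g _ ->] := Sylow_trans sylP sylR.
by rewrite abelianJ.
Qed.

(** The index equals that in [N] of a subgroup containing [N :&: P], so it divides
    [#|N : N :&: P|]. *)
Lemma Sylow_cycle_mulN G N P x :
    N <| G -> p.-Sylow(G) P -> x \in P ->
  p.-Sylow(<[x]> <*> N) (<[x]> <*> (N :&: P)).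
Proof.
move=> nNG sylP Px; have /and3P[_ _ p'NQ] := Sylow_setI_normal nNG sylP.
have sxP : <[x]> \subset P by rewrite cycle_subG.
have nNP := subset_trans (pHall_sub sylP) (normal_norm nNG).
have defM : <[x]> <*> N = (<[x]> <*> (N :&: P)) * N.
  rewrite !norm_joinEl ?(subset_trans sxP) //; last first.
    by rewrite normsI ?normG.
  by rewrite -mulgA (mulSGid (subsetIl N P)).
apply/and3P; split.
- by rewrite genS // setUS ?subsetIl.
- apply: pgroupS (pHall_pgroup sylP).
  by rewrite join_subG sxP subsetIr.
rewrite defM indexMg -indexgI; apply: pnat_dvd p'NQ.
by rewrite indexgS //= subsetI subsetIl joing_subr.
Qed.

Lemma Sylow_cent_setI_normal G N P :
    p'_classes p G -> N <| G -> p.-Sylow(G) P -> abelian (N :&: P) ->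
  P \subset 'C(N :&: P).
Proof.
move=> clG nNG sylP abQ; apply/subsetP=> x Px.
have Gx := subsetP (pHall_sub sylP) x Px.
have [R sylR /setIP[Rx cxR]] :=
  Sylow_center_p'classes clG Gx (mem_p_elt (pHall_pgroup sylP) Px).
have abR : abelian (N :&: R).
  by apply: abelian_Sylow_trans abQ; apply: Sylow_setI_normal nNG _.
have abRx : abelian (<[x]> <*> (N :&: R)).
  rewrite abelianY cycle_abelian abR /= cent_cycle.
  by rewrite subIset // !sub_cent1 cxR orbT.
have abPx : abelian (<[x]> <*> (N :&: P)).
  by apply: abelian_Sylow_trans abRx; apply: Sylow_cycle_mulN nNG _ _.
by move: abPx; rewrite abelianY cent_cycle sub_cent1 => /and3P[].
Qed.

Lemma abelian_Sylow_extension G N P :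
    p'_classes p G -> N <| G -> p.-Sylow(G) P ->
  abelian (N :&: P) -> abelian (P / N) -> abelian P.
Proof.
move=> clG nNG sylP abQ abPN; apply/subsetP=> x Px.
have sPG := pHall_sub sylP; have nNP := subset_trans sPG (normal_norm nNG).
have cPQ : N :&: P \subset 'C(P) by rewrite centsC (Sylow_cent_setI_normal clG).
have Gx := subsetP sPG x Px.
have [R sylR ZRx] :=
  Sylow_center_p'classes clG Gx (mem_p_elt (pHall_pgroup sylP) Px).
have [g Gg defP] := Sylow_trans sylR sylP.
have nNg := subsetP (normal_norm nNG) g Gg.
have nNx := subsetP nNP x Px.
have /setIP[Py cPy] : x ^ g \in 'Z(P).
  by rewrite defP /center centJ -conjIg memJ_conjg.
have nNy := subsetP nNP _ Py.
(* [P] and [P :^ g] both centralise [x ^ g] modulo [N], as [P / N] is abelian and [x], [x ^ g] lie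
   in [P]; so both are Sylow in [D]. *)
pose D := (G :&: coset N @*^-1 'C[coset N (x ^ g)])%G.
have sylD (S : {group gT}) :
    p.-Sylow(G) S -> S / N \subset 'C[coset N (x ^ g)] -> p.-Sylow(D) S.
  move=> sylS cSy; have sSG := pHall_sub sylS.
  apply: (pHall_subl _ (subsetIl _ _) sylS).
  by rewrite subsetI sSG -sub_quotient_pre // (subset_trans sSG) ?normal_norm.
have sylDP : p.-Sylow(D) P.
  apply: sylD => //; rewrite sub_cent1; apply: (subsetP abPN).
  exact: mem_quotient.
have sylDPg : p.-Sylow(D) (P :^ g)%G.
  apply: sylD; first by rewrite pHallJ.
  rewrite quotientJ // morphJ // cent1J conjSg sub_cent1.
  by rewrite (subsetP abPN) // mem_quotient.
have [d /setIP[Gd /morphpreP[nNd /cent1P cdy]] defPn] :=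
  Sylow_trans sylDPg sylDP.
(* The normalising element is [g * d]; since [d] fixes [x ^ g] modulo [N], [x ^ (g * d)] and [x ^ g]
   differ by an element of [N :&: P]. *)
have nPn : P :^ (g * d) = P by rewrite conjsgM -defPn.
have Pxn : x ^ (g * d) \in P by rewrite -nPn memJ_conjg.
have Qxn : x ^ (g * d) * (x ^ g)^-1 \in N :&: P.
  rewrite inE andbC groupM ?groupV //= coset_idr //.
    by rewrite groupM ?groupV ?(subsetP nNP).
  rewrite morphM ?morphV ?groupV ?(subsetP nNP _ Pxn) // conjgM.
  by rewrite (morphJ _ nNy nNd) /= conjgE -cdy mulKg mulgV.
rewrite -(memJ_conjg _ (g * d)) -centJ nPn -(mulgKV (x ^ g) (x ^ (g * d))).
by rewrite groupM // (subsetP cPQ).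
Qed.

End ClassSizes.

Theorem corollary4p2 (p : nat) (p_prime : prime p) (p_odd : odd p)
    (gT : finGroupType) (G : {group gT}) (clG : cl_group p G) :
  exists H K : {group gT},
    [/\ H \subset G, K <| H, simple (H / K) & cl_group p (H / K)%G].
Proof.
have [n] := ubnP #|G|; elim: n => // n IHn in G clG *; rewrite ltnS => leGn.
have [nabSyl p'G] := clG.
have nabG (P : {group gT}) : p.-Sylow(G) P -> ~~ abelian P.
  by move=> sylP; rewrite nabSyl ?inE.
have ntG : G :!=: 1.
  apply/eqP=> G1; have [P sylP] := Sylow_exists p G.
  have /negP[] := nabG P sylP.
  by rewrite (abelianS (pHall_sub sylP)) // G1 abelian1.
have [K maxK] := ex_maxnormal_ntrivg ntG.
have nKG := maxnormal_normal maxK.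
have ltKG := maxnormal_proper maxK.
have [R sylR] := Sylow_exists p K.
have [abR | nabR] := boolP (abelian R); last first.
  have clK : cl_group p K.
    split; last exact: p'_classes_normal nKG p'G.
    move=> P; rewrite inE => sylP; apply: contra nabR.
    exact: abelian_Sylow_trans sylP sylR.
  have [|H [L [sHK nLH simHL clHL]]] := IHn K clK.
    exact: leq_trans (proper_card ltKG) leGn.
  by exists H, L; split; rewrite ?(subset_trans sHK (proper_sub ltKG)).
exists G, K; split; rewrite ?quotient_simple //.
split; last exact: p'_classes_quotient.
move=> S; rewrite inE => sylS; have [P sylP] := Sylow_exists p G.
(* Otherwise the Sylow subgroups of both [K] and [G / K] are abelian, forcing [P] to be abelian. *)
apply: contra (nabG P sylP) => abS.
apply: (abelian_Sylow_extension p_prime p'G nKG sylP).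
  by apply: abelian_Sylow_trans abR; last exact: Sylow_setI_normal nKG sylP.
apply: abelian_Sylow_trans abS; first exact: sylS.
apply: quotient_pHall => //.
by rewrite (subset_trans (pHall_sub sylP)) ?normal_norm.
Qed.
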